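(* Cluster Vertex Deletion parameterized by solution size $k$ is $(\mathrm{VA}, n/p, p)$-hard for every $p\in\mathbb{N}$, even when restricted to input graphs $G$ with maximum degree $\Delta(G)=O(1)$.
   Context: All graphs are finite, simple and undirected; $n$ is the number of vertices of the input graph $G$, and the vertex set is known in advance. $\Delta(G)$ denotes the maximum degree of $G$; ''restricted to graphs with $\Delta(G)=O(1)$'' means that the hardness holds already for inputs whose maximum degree is at most some absolute constant. Cluster Vertex Deletion: the input is a graph $G$ (presented as a stream) and a non-negative integer $k$; the question is whether there is a set $X\subset V(G)$ of size at most $k$ such that $G\setminus X$ (the subgraph induced by $V(G)\setminus X$) is a cluster graph, i.e. a disjoint union of cliques, equivalently contains no induced path $P_3$ on three vertices. VA (vertex arrival) model: the vertices are exposed one after another in an arbitrary order; when a vertex $v$ is exposed, all edges between $v$ and its already exposed neighbors are revealed one by one in an arbitrary order. A $p$-pass streaming algorithm may read the stream $p$ times in the same order. It solves a problem in a streaming model if it is a (possibly randomized) algorithm which, on every input instance presented in that model, gives the correct output with probability at least $2/3$. For a streaming model $\mathcal{M}$ and a function $f$ of $n$ and the parameter, a problem is $(\mathcal{M},f,p)$-hard if no $p$-pass streaming algorithm using $o(f)$ bits of space solves it in model $\mathcal{M}$. *)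

(* Defs.v *)
From mathcomp Require Import all_boot all_order all_algebra.
From mathcomp Require Import reals.

Set Implicit Arguments.
Unset Strict Implicit.
Unset Printing Implicit Defensive.

Import Order.TTheory GRing.Theory Num.Theory.

Record sgraph (T : finType) := SGraph {
  adj : rel T;
  adj_sym : symmetric adj;
  adj_irr : irreflexive adj
}.

Section Graphs.
Variable T : finType.
Implicit Types (G : sgraph T) (A : {set T}).

Definition max_degree G : nat := \max_(v : T) #|[set u | adj G v u]|.

Definition induced_adj G A : rel {x : T | x \in A} :=
  fun u v => adj G (val u) (val v).

Lemma induced_sym G A : symmetric (@induced_adj G A).
Proof. by move=> u v; apply: adj_sym. Qed.

Lemma induced_irr G A : irreflexive (@induced_adj G A).
Proof. by move=> u; apply: adj_irr. Qed.

Definition induced G A : sgraph {x : T | x \in A} :=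
  SGraph (@induced_sym G A) (@induced_irr G A).

(* Disjoint union of cliques: the blocks of P are the cliques. *)
Definition is_cluster G : bool :=
  [exists P : {set {set T}}, partition P [set: T] &&
    [forall u, forall v,
       (u != v) ==> (adj G u v == (pblock P u == pblock P v))]].

End Graphs.

Definition cluster_vertex_deletion (T : finType) (G : sgraph T) (k : nat) :
    bool :=
  [exists X : {set T}, (#|X| <= k)%N && is_cluster (induced G (~: X))].

(* [Edge v u] reveals the edge between the vertex [v] being exposed and an
   already exposed vertex [u]. *)
Inductive token (T : Type) := Vertex of T | Edge of T & T.

(* [ord] is the order of exposure, and [nb v] the order in which the edges from
   [v] to its already exposed neighbours are revealed. *)
Definition VA (T : finType) (G : sgraph T) (S : seq (token T)) : Prop :=
  exists (ord : seq T) (nb : T -> seq T),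
    [/\ perm_eq ord (enum T),
        forall v, perm_eq (nb v)
          [seq u <- ord | adj G v u && (index u ord < index v ord)%N]
      & S = flatten [seq Vertex v :: [seq Edge v u | u <- nb v] | v <- ord]].

Local Open Scope ring_scope.

(* A randomized streaming algorithm on vertex set 'I_n whose memory holds s
   bits: a finite probability distribution on deterministic automata with
   state space {0,1}^s.  The seed collects all the coin tosses and is not
   charged to the space.  Since [step] may depend on the number of the current
   pass and on the position in the stream, fresh coins at every step are
   covered.  As n and s are fixed and streams on 'I_n have bounded length, only
   finitely many deterministic behaviours exist, so that restricting to finite
   distributions loses no generality. *)
Record stream_alg (R : realType) (n s : nat) := StreamAlg {
  seed : finType;
  weight : seed -> R;
  weight_ge0 : forall w, 0 <= weight w;
  weight_sum1 : \sum_w weight w = 1;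
  init : seed -> s.-tuple bool;
  step : seed -> nat -> nat -> s.-tuple bool -> token 'I_n -> s.-tuple bool;
  output : seed -> s.-tuple bool -> bool
}.

Section Runs.
Variables (R : realType) (n s : nat) (A : stream_alg R n s).
Implicit Types (w : seed A) (m : s.-tuple bool) (S : seq (token 'I_n)).

(* Reads S in pass i, from position t on and starting with memory m. *)
Fixpoint read_stream w (i t : nat) m S : s.-tuple bool :=
  if S is x :: S' then read_stream w i t.+1 (step w i t m x) S' else m.

Definition run (p : nat) w S : s.-tuple bool :=
  foldl (fun m i => read_stream w i 0 m S) (init w) (iota 0 p).

Definition prob_output (p : nat) S (b : bool) : R :=
  \sum_(w | output w (run p w S) == b) weight w.

End Runs.

Definition graph_problem := forall n : nat, sgraph 'I_n -> nat -> bool.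
Definition graph_class := forall n : nat, sgraph 'I_n -> bool.
Definition stream_model :=
  forall n : nat, sgraph 'I_n -> seq (token 'I_n) -> Prop.

(* The number n of vertices and the parameter k are known in advance, hence one
   algorithm for each pair (n, k). *)
Definition solves (R : realType) (Pi : graph_problem) (C : graph_class)
    (M : stream_model) (p : nat) (s : nat -> nat -> nat)
    (A : forall n k : nat, stream_alg R n (s n k)) : Prop :=
  forall (n k : nat) (G : sgraph 'I_n) (S : seq (token 'I_n)),
    C n G -> M n G S -> 2%:R / 3%:R <= prob_output (A n k) p S (Pi n G k).

(* s = o(f) as n tends to infinity, uniformly in the parameter k. *)
Definition little_o (R : realType) (s : nat -> nat -> nat)
    (f : nat -> nat -> R) : Prop :=
  forall eps : R, 0 < eps ->
    exists N : nat, forall n k : nat, (N <= n)%N -> (s n k)%:R <= eps * f n k.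

(* Pi, restricted to the inputs in C, is (M, f, p)-hard. *)
Definition stream_hard (R : realType) (Pi : graph_problem) (C : graph_class)
    (M : stream_model) (f : nat -> nat -> R) (p : nat) : Prop :=
  ~ exists (s : nat -> nat -> nat)
           (A : forall n k : nat, stream_alg R n (s n k)),
      little_o s f /\ solves Pi C M p A.

(* Main.v *)
(** Alice and Bob hold x and y in {0,1}^m with m = 2h.  A cyclic chain of m
    blocks of constant size encodes the inner product of x and y modulo 2: in
    each block an independent set can use at most one node that guesses
    (parity so far, x_i, y_i) and the two nodes that refute wrong guesses of
    x_i and of y_i, and guesses of consecutive blocks conflict unless the parity
    is updated correctly.  Hence there is an independent set of size 3m exactly
    if the parity returns to its initial value, i.e. if the inner product is 0.
    Attaching a pendant vertex to every node turns vertex cover into cluster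
    vertex deletion.  The edges that depend on x are exposed before those that
    depend on y, so a p-pass algorithm with s bits splits {0,1}^m x {0,1}^m into
    at most 2^(2ps) rectangles on each of which its answer is constant.  By
    Lindsey's lemma the discrepancy of the inner product on a rectangle is at
    most 2^(3h), and therefore 2^(4h) <= 3 * 2^(2ps) * 2^(3h), which forces
    s to be at least of order n / p. *)

Require Import Defs.
From mathcomp Require Import all_boot all_order all_algebra.
From mathcomp Require Import reals.
From mathcomp Require Import zify ring lra.

Set Implicit Arguments.
Unset Strict Implicit.
Unset Printing Implicit Defensive.

Import Order.TTheory GRing.Theory Num.Theory.

(** * Cluster graphs and their deletion sets via induced paths on three vertices *)

Lemma is_clusterP (T : finType) (G : sgraph T) :
  reflect (forall u v w, adj G u v -> adj G v w -> u != w -> adj G u w)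
          (is_cluster G).
Proof.
apply: (iffP existsP) => [[P /andP[_ /forallP cl]] u v w uv vw neq_uw | P3free].
  have block a b : adj G a b -> pblock P a == pblock P b.
    move=> ab; have neq_ab : a != b.
      by apply: contraTneq ab => ->; rewrite adj_irr.
    by have /forallP/(_ b) := cl a; rewrite neq_ab ab => /eqP <-.
  have /forallP/(_ w) := cl u; rewrite neq_uw /= => /eqP ->.
  by rewrite (eqP (block _ _ uv)) block.
(* Without induced paths on three vertices, being equal or adjacent is an equivalence relation; its
   classes are the cliques. *)
pose e : rel T := fun u v => (u == v) || adj G u v.
have eqe : {in [set: T] & &, equivalence_rel e}.
  apply/equivalence_relP_in; split=> [u _|]; first by rewrite /e eqxx.
  have sub u v w : e u v -> e u w -> e v w.
    move=> /orP[/eqP->//|uv] /orP[/eqP<-|uw]; first by rewrite /e adj_sym uv orbT.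
    rewrite /e; have [//|neq_vw] /= := eqVneq v w.
    by apply: P3free neq_vw; [rewrite adj_sym; exact: uv | exact: uw].
  have symm u v : e u v -> e v u by rewrite /e eq_sym adj_sym.
  move=> u v _ _ euv w _; apply/idP/idP => ew; first exact: sub euv ew.
  exact: sub (symm _ _ euv) ew.
exists (equivalence_partition e [set: T]).
rewrite equivalence_partitionP //=.
apply/forallP => u; apply/forallP => v; apply/implyP => neq_uv.
have := pblock_equivalence_partition eqe (in_setT u) (in_setT v).
rewrite /e (negbTE neq_uv) /= => <-.
have /and3P[/eqP cov triv _] := equivalence_partitionP eqe.
by rewrite eq_pblock ?cov ?inE.
Qed.

Lemma cluster_vertex_deletionP (T : finType) (G : sgraph T) k :
  reflect (exists2 X : {set T}, (#|X| <= k)%N &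
            forall u v w, u \notin X -> v \notin X -> w \notin X ->
              adj G u v -> adj G v w -> u != w -> adj G u w)
          (cluster_vertex_deletion G k).
Proof.
apply: (iffP existsP) => [[X /andP[leX /is_clusterP cl]] | [X leX P3free]].
  exists X => // u v w uX vX wX; rewrite -!in_setC in uX vX wX.
  exact: (cl (exist _ u uX) (exist _ v vX) (exist _ w wX)).
exists X; rewrite leX; apply/is_clusterP => u v w uv vw neq_uw.
by apply: P3free uv vw neq_uw; rewrite -in_setC ?(valP u) ?(valP v) ?(valP w).
Qed.

Section Relabel.
Variables (T T' : finType) (f : T' -> T) (G : sgraph T).

Definition relabel : sgraph T' :=
  @SGraph _ (relpre f (adj G)) (fun u v => adj_sym G (f u) (f v))
    (fun u => adj_irr G (f u)).

Lemma cluster_vertex_deletion_relabel k : bijective f ->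
  cluster_vertex_deletion relabel k = cluster_vertex_deletion G k.
Proof.
case=> g fK gK; have injf := can_inj fK; have injg := can_inj gK.
apply/cluster_vertex_deletionP/cluster_vertex_deletionP => -[X leX P3free].
  exists [set f x | x in X]; first by rewrite card_imset.
  move=> u v w; rewrite -(gK u) -(gK v) -(gK w) !mem_imset // (inj_eq injf).
  exact: P3free.
exists [set g x | x in X]; first by rewrite card_imset.
move=> u v w; rewrite -(fK u) -(fK v) -(fK w) !mem_imset // (inj_eq injg) !fK.
exact: P3free.
Qed.

End Relabel.

(** * From independent sets to cluster vertex deletion by pendant vertices *)

Section Corona.
Variables (V : finType) (G : sgraph V).

(* A pendant vertex [(v, true)] is attached to every vertex [(v, false)]. *)
Definition corona_adj : rel (V * bool) := fun u v =>
  if u.2 || v.2 then (u.1 == v.1) && (u.2 != v.2) else adj G u.1 v.1.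

Lemma corona_sym : symmetric corona_adj.
Proof. by case=> u [] [v []]; rewrite /corona_adj /= 1?eq_sym // adj_sym. Qed.

Lemma corona_irr : irreflexive corona_adj.
Proof. by case=> u []; rewrite /corona_adj /= ?eqxx ?adj_irr. Qed.

Definition corona : sgraph (V * bool)%type := SGraph corona_sym corona_irr.

Definition independent (I : {set V}) := forall u v,
  u \in I -> v \in I -> ~~ adj G u v.

(* An edge whose ends both keep their pendants would leave an induced path, so
   a solution of the corona projects onto a vertex cover of [G]. *)
Lemma cluster_vertex_deletion_corona k :
  cluster_vertex_deletion corona k <->
  exists2 I, independent I & (#|V| <= #|I| + k)%N.
Proof.
split=> [/cluster_vertex_deletionP[X leX P3free] | [I indI leI]].
  exists (~: [set x.1 | x in X]) => [u v|]; last first.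
    by rewrite -(cardsC [set x.1 | x in X]) addnC leq_add2l
               (leq_trans (leq_imset_card _ _)).
  rewrite !inE => uX vX; apply/negP => uv.
  have notinX w b : w \notin [set x.1 | x in X] -> (w, b) \notin X.
    by apply: contra => wX; apply/imsetP; exists (w, b).
  have := P3free (u, true) (u, false) (v, false).
  rewrite !notinX // /corona /corona_adj /= eqxx uv xpair_eqE andbT andbF.
  rewrite andbT => /(_ isT isT isT isT isT isT) /eqP equv.
  by rewrite equv adj_irr in uv.
apply/cluster_vertex_deletionP.
exists [set (v, false) | v in ~: I].
  rewrite card_imset => [|u v [->] //].
  by rewrite -(leq_add2l #|I|) cardsC.
have inI v : (v, false) \notin [set (v, false) | v in ~: I] -> v \in I.
  by apply: contraR => vI; apply: imset_f; rewrite inE.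
(* Every surviving edge joins a vertex to its own pendant, so a walk [u], [v], [w] ends at
   [w = u]. *)
have pendant u v : u \notin [set (v, false) | v in ~: I] ->
    v \notin [set (v, false) | v in ~: I] -> corona_adj u v -> v = (u.1, ~~ u.2).
  case: u v => [u a] [v b] uI vI; rewrite /corona_adj /=.
  case: a b uI vI => [] [] // uI vI; try by case/andP => /eqP->.
  by move/inI in uI; move/inI in vI; rewrite (negbTE (indI _ _ uI vI)).
move=> u v w uI vI wI uv vw.
rewrite (pendant _ _ vI wI vw) (pendant _ _ uI vI uv) /= negbK.
by case: (u) => ? ?; rewrite eqxx.
Qed.

End Corona.

Lemma max_degree_relabel (T T' : finType) (f : T' -> T) (G : sgraph T) :
  injective f -> (max_degree (relabel f G) <= max_degree G)%N.
Proof.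
move=> injf; apply/bigmax_leqP => v _.
apply: leq_trans (leq_bigmax (f v)).
rewrite -(card_imset _ injf); apply/subset_leq_card/subsetP => _ /imsetP[u + ->].
by rewrite !inE.
Qed.

(** * Parities along a cycle *)

Section CyclicParity.
Variable m : nat.
Implicit Types (s t : 'I_m -> bool).

(** Each [s i] enters the sum of [s i (+) s (ordS i)] twice, as [ordS] is a bijection. *)
Lemma addb_cycle0 s t : (forall i, s (ordS i) = s i (+) t i) ->
  \big[addb/false]_i t i = false.
Proof.
move=> st; have -> : \big[addb/false]_i t i =
    \big[addb/false]_i (s i (+) s (ordS i)).
  by apply: eq_bigr => i _; rewrite st addKb.
rewrite big_split /= [X in _ (+) X](_ : _ = \big[addb/false]_i s i) ?addbb //.
by rewrite [RHS](reindex (@ordS m)) //=; apply: onW_bij; apply: ordS_bij.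
Qed.

(** The prefix sums of [t] work; they close up at the last index because the total vanishes. *)
Lemma cyclic_potential t : \big[addb/false]_i t i = false ->
  exists s, forall i, s (ordS i) = s i (+) t i.
Proof.
move=> t0; pose t' k := if insub k is Some i then t i else false.
pose S k := \big[addb/false]_(0 <= j < k) t' j.
have S0 : S 0 = false by rewrite /S big_geq.
have Sm : S m = false.
  rewrite /S big_mkord -[RHS]t0; apply: eq_bigr => i _.
  by rewrite /t' insubT //= => lt_i; congr t; apply: val_inj.
exists (fun i => S i) => i /=.
have -> : S i (+) t i = S i.+1.
  by rewrite /S big_nat_recr //= /t' valK.
have [eq_i|neq_i] := eqVneq i.+1 m; first by rewrite eq_i modnn S0 Sm.
by rewrite modn_small // ltn_neqAle neq_i ltn_ord.
Qed.

End CyclicParity.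

Definition inner_product m (x y : {ffun 'I_m -> bool}) : bool :=
  \big[addb/false]_i (x i && y i).

(** * The graph of an inner product instance *)

Section InnerProductGraph.
Variable m : nat.
Notation cube := {ffun 'I_m -> bool}.

(* Block [i] consists of eight nodes [(i, inl (s, a, b))], which guess the
   parity [s] of the products before [i] and the bits [a = x i] and [b = y i],
   and of two nodes [(i, inr true)], [(i, inr false)] that refute wrong guesses
   of [x i] and of [y i], respectively. *)
Definition ip_node : predArgType := ('I_m * (bool * bool * bool + bool))%type.

Definition ip_edge (x y : cube) : rel ip_node := fun u v =>
  match u.2, v.2 with
  | inl (s, a, b), inl (s', _, _) =>
      (u.1 == v.1) || (v.1 == ordS u.1) && (s' != s (+) (a && b))
  | inl (_, a, b), inr w =>
      (u.1 == v.1) && (if w then a != x u.1 else b != y u.1)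
  | _, _ => false
  end.

Definition ip_adj x y : rel ip_node := fun u v =>
  (u != v) && (ip_edge x y u v || ip_edge x y v u).

Lemma ip_adj_sym x y : symmetric (ip_adj x y).
Proof. by move=> u v; rewrite /ip_adj eq_sym orbC. Qed.

Lemma ip_adj_irr x y : irreflexive (ip_adj x y).
Proof. by move=> u; rewrite /ip_adj eqxx. Qed.

Definition ip_graph x y : sgraph ip_node :=
  SGraph (@ip_adj_sym x y) (@ip_adj_irr x y).

Lemma card_ip_node : #|{: ip_node}| = (10 * m)%N.
Proof. by rewrite card_prod card_sum !card_prod !card_bool card_ord mulnC. Qed.

Lemma independent_ip_graph x y : (1 < m)%N ->
  (exists2 I, independent (ip_graph x y) I & (3 * m <= #|I|)%N) <->
  inner_product x y = false.
Proof.
move=> m_gt1; pose slots : predArgType := ('I_m * option bool)%type.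
have card_slots : #|{: slots}| = (3 * m)%N.
  by rewrite card_prod card_option card_bool card_ord mulnC.
(* With a single block, [ordS i] would be [i] itself; this is what [1 < m] excludes. *)
have neq_ordS (i : 'I_m) : i != ordS i.
  rewrite -val_eqE /=; have lt_i := ltn_ord i.
  have [eq_i|neq_i] := eqVneq i.+1 m; first by rewrite eq_i modnn; lia.
  by rewrite modn_small; lia.
split=> [[I indI leI] | ip0].
  pose slot (u : ip_node) : slots :=
    (u.1, if u.2 is inr w then Some w else None).
  have inj_slot : {in I &, injective slot}.
    move=> [i u] [j v] uI vI [eq_ij eq_uv].
    have := indI _ _ uI vI; rewrite /= /ip_adj negb_and negbK -eq_ij.
    case: u v eq_uv {uI vI} => [[[s a] b]|w] [[[s' a'] b']|w'] //=; last by case=> ->.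
    by move=> _; rewrite /ip_edge /= eqxx orbF => /eqP.
  (* At least [3 * m] nodes injected into [3 * m] slots leave no slot empty. *)
  have full : slot @: I = setT.
    apply/eqP; rewrite eqEcard subsetT cardsT card_slots.
    by rewrite card_in_imset.
  have refuter i w : (i, inr w) \in I.
    have : (i, Some w) \in slot @: I by rewrite full inE.
    by case/imsetP=> -[j [c|w']] // uI [-> ->].
  have /fin_all_exists[c cI] i : exists c, (i, inl c) \in I.
    have : (i, None) \in slot @: I by rewrite full inE.
    by case/imsetP=> -[j [c|w']] // uI [->]; exists c.
  apply: (@addb_cycle0 _ (fun i => (c i).1.1)) => i.
  have := indI _ _ (cI i) (refuter i true).
  have := indI _ _ (cI i) (refuter i false).
  have := indI _ _ (cI i) (cI (ordS i)).
  rewrite /= /ip_adj /ip_edge /= !xpair_eqE (negbTE (neq_ordS i)) /= !eqxx.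
  case: (c i) (c (ordS i)) => [[s a] b] [[s' a'] b'] /=.
  by rewrite !orbF negb_or !negbK => /andP[/eqP-> _] /eqP-> /eqP->.
have [s sP] := cyclic_potential ip0.
pose node (p : slots) : ip_node :=
  (p.1, if p.2 is Some w then inr w else inl (s p.1, x p.1, y p.1)).
have inj_node : injective node.
  by move=> [i [w|]] [j [w'|]] [] // -> => [->|].
exists (node @: setT); last by rewrite card_imset // cardsT card_slots.
have no_edge p q : node p != node q -> ~~ ip_edge x y (node p) (node q).
  case: p q => [i [w|]] [j [w'|]] //; rewrite /ip_edge /node /=.
    by move=> _; case: eqP => //= ->; case: w'; rewrite eqxx.
  have [->|_] /= := eqVneq i j; first by rewrite eqxx.
  by move=> _; case: eqP => // ->; rewrite sP eqxx.
move=> _ _ /imsetP[p _ ->] /imsetP[q _ ->] /=.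
rewrite /ip_adj; have [//|neq] := eqVneq (node p) (node q).
by rewrite negb_or !no_edge // eq_sym.
Qed.

(** The budget is what an independent set of size [3 * m] leaves of the [10 * m] nodes. *)
Lemma cluster_vertex_deletion_ip x y : (1 < m)%N ->
  cluster_vertex_deletion (corona (ip_graph x y)) (7 * m) = ~~ inner_product x y.
Proof.
move=> m_gt1; apply/idP/negPf => [/cluster_vertex_deletion_corona|].
  case=> I indI leI; apply/independent_ip_graph => //; exists I => //.
  by move: leI; rewrite card_ip_node; lia.
move/independent_ip_graph => /(_ m_gt1) [I indI leI].
apply/cluster_vertex_deletion_corona; exists I => //.
by rewrite card_ip_node; lia.
Qed.

(** Neighbours lie in the same block or the two next to it, each with ten nodes and ten pendants. *)
Lemma max_degree_ip x y : (max_degree (corona (ip_graph x y)) <= 60)%N.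
Proof.
apply/bigmax_leqP => -[[i k] c] _.
pose N : {set ip_node * bool} :=
  setX (setX [set i; ordS i; ord_pred i] [set: bool * bool * bool + bool])
    [set: bool].
apply: (@leq_trans #|N|); last first.
  rewrite !cardsX !cardsT card_sum !card_prod !card_bool.
  rewrite -[60%N]/(3 * 10 * 2)%N !leq_mul2r /=.
  by rewrite setUC cardsU1 cards2; case: (_ \in _) (_ == _) => [] [].
apply/subset_leq_card/subsetP => -[[j k'] c']; rewrite !inE !andbT /=.
rewrite /corona_adj /=; case: ifP => _; first by case/andP => /eqP[->]; rewrite eqxx.
have edge (i' j' : 'I_m) l l' : ip_edge x y (i', l) (j', l') ->
    (i' == j') || (j' == ordS i').
  rewrite /ip_edge /=; case: l l' => [[[? ?] ?]|?] [[[? ?] ?]|?] //.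
    by case/orP=> [->//|/andP[-> _]]; rewrite orbT.
  by case/andP => ->.
case/andP=> _ /orP[] /edge /orP[/eqP->|/eqP->]; rewrite ?eqxx ?orbT //.
by rewrite ordSK eqxx orbT.
Qed.

End InnerProductGraph.

(** * Vertex arrival streams split between Alice and Bob *)

Section VertexArrivalStream.
Variables (T : finType) (G : sgraph T).

Definition expose (nb : T -> seq T) (ord : seq T) : seq (token T) :=
  flatten [seq Vertex v :: [seq Edge v u | u <- nb v] | v <- ord].

Definition earlier (s0 : seq T) (v : T) : seq T :=
  [seq u <- s0 | adj G v u && (index u s0 < index v s0)%N].

(** What a vertex of [s1] reveals does not depend on the rest of [s1], so the suffix can be cut
    between the two players. *)
Lemma VA_independent_suffix (s0 s1 : seq T) : perm_eq (s0 ++ s1) (enum T) ->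
  {in s1 &, forall u v, ~~ adj G u v} ->
  VA G (expose (earlier s0) s0 ++ expose (fun v => [seq u <- s0 | adj G v u]) s1).
Proof.
move=> perm_ord ind.
have uniq_ord : uniq (s0 ++ s1) by rewrite (perm_uniq perm_ord) enum_uniq.
have notin v : v \in s1 -> v \notin s0.
  move: uniq_ord; rewrite cat_uniq => /and3P[_ /hasPn dis _]; exact: dis.
exists (s0 ++ s1), (fun v => if v \in s0 then earlier s0 v else
  [seq u <- s0 | adj G v u]); split=> // [v|]; last first.
  rewrite map_cat flatten_cat; congr (_ ++ _); congr flatten.
    by apply/eq_in_map => v ->.
  by apply/eq_in_map => v /notin/negbTE->.
rewrite filter_cat [X in _ ++ X](_ : _ = [::]) ?cats0; last first.
  apply/eqP; rewrite -size_eq0 size_filter -leqn0 leqNgt -has_count.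
  apply/hasPn => u us1; rewrite negb_and -leqNgt.
  have [vs1|vs1] := boolP (v \in s1); first by rewrite ind.
  rewrite !index_cat (negbTE (notin _ us1)).
  case: ifP => vs0; first by rewrite (leq_trans (index_size v s0)) ?leq_addr ?orbT.
  have: v \in s0 ++ s1 by rewrite (perm_mem perm_ord) mem_enum.
  by rewrite mem_cat vs0 (negbTE vs1).
apply/seq.permP => P; congr (count P _); case: ifP => vs0.
  by apply: eq_in_filter => u us0; rewrite !index_cat us0 vs0.
apply: eq_in_filter => u us0; rewrite !index_cat us0 vs0.
by rewrite (leq_trans _ (leq_addr _ _)) ?index_mem ?andbT.
Qed.

End VertexArrivalStream.

Section InnerProductStream.
Variable m : nat.
Notation cube := {ffun 'I_m -> bool}.

Definition ip_vertex : predArgType := (ip_node m * bool)%type.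
Notation N := #|{: ip_vertex}|.

Lemma card_ip_vertex : N = (20 * m)%N.
Proof. by rewrite card_prod card_ip_node card_bool; lia. Qed.

Definition ip_input (x y : cube) : sgraph 'I_N :=
  relabel enum_val (corona (ip_graph x y)).

Definition refuter (w : bool) : pred ip_vertex := fun v =>
  if v is ((_, inr w'), false) then w' == w else false.

Definition core : pred ip_vertex := fun v => ~~ refuter true v && ~~ refuter false v.

Definition ip_order (P : pred ip_vertex) : seq 'I_N :=
  [seq u <- enum 'I_N | P (enum_val u)].

Lemma mem_ip_order P u : (u \in ip_order P) = P (enum_val u).
Proof. by rewrite mem_filter mem_enum andbT. Qed.

Lemma uniq_ip_order P : uniq (ip_order P).
Proof. by rewrite filter_uniq // enum_uniq. Qed.

Lemma refuterP w v : reflect (exists i, v = ((i, inr w), false)) (refuter w v).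
Proof.
apply: (iffP idP) => [|[i ->]]; last by rewrite /= eqxx.
by case: v => [[i [c|w']] []] //= /eqP->; exists i.
Qed.

(** Input bits affect only edges at refuters. The pendants of refuters belong to [core]. *)
Lemma adj_core x y x' y' u v : core u -> core v ->
  adj (corona (ip_graph x y)) u v = adj (corona (ip_graph x' y')) u v.
Proof.
by case: u v => [[i [[[s a] b]|[]]] []] [[j [[[s' a'] b']|[]]] []].
Qed.

Lemma adj_refuter_true x y y' u v : refuter true u -> core v ->
  adj (corona (ip_graph x y)) u v = adj (corona (ip_graph x y')) u v.
Proof.
by case/refuterP=> i ->; case: v => [[j [[[s' a'] b']|[]]] []].
Qed.

Lemma adj_refuter_false x x' y u v : refuter false u -> core v ->
  adj (corona (ip_graph x y)) u v = adj (corona (ip_graph x' y)) u v.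
Proof.
by case/refuterP=> i ->; case: v => [[j [[[s' a'] b']|[]]] []].
Qed.

(** Whatever [x i] is, four guesses have the wrong first bit; the pendant is the fifth neighbour.
    The degree being constant fixes the length of Alice's stream. *)
Lemma degree_refuter_true x y u : refuter true u ->
  #|[set v | core v & adj (corona (ip_graph x y)) u v]| = 5%N.
Proof.
case/refuterP => i ->; pose nbr (o : option (bool * bool)) : ip_vertex :=
  if o is Some (s, b) then ((i, inl (s, ~~ x i, b)), false)
  else ((i, inr true), true).
have inj_nbr : injective nbr by move=> [[? ?]|] [[? ?]|] //= [-> ->].
have -> : 5 = #|[set nbr o | o in [set: option (bool * bool)]]|.
  by rewrite card_imset // cardsT card_option card_prod card_bool.
congr #|pred_of_set _|; apply/setP => v; rewrite inE.
apply/idP/imsetP => [|[[[s b]|] _ ->]]; last 2 first.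
- rewrite /= /corona_adj /= /ip_adj /ip_edge /= xpair_eqE !eqxx /=.
  by case: (x i).
- by rewrite /= /corona_adj /= eqxx.
case: v => [[j [[[s a] b]|w]] []] //=; rewrite /corona_adj /= ?xpair_eqE /=.
- by rewrite ?andbF.
- rewrite /ip_adj /ip_edge /= => /and3P[_ /eqP-> neq_a]; exists (Some (s, b)); rewrite ?inE //=.
  by case: a (x i) neq_a => [] [].
- by move=> /andP[/andP[/eqP<- /eqP[<-]] _]; exists None; rewrite ?inE.
by case: w.
Qed.

Lemma ip_stream :
  exists (t0 : nat) (SA SB : cube -> seq (token 'I_N)),
    (forall x, size (SA x) = t0) /\
    (forall x y, VA (ip_input x y) (SA x ++ SB y)).
Proof.
(* A placeholder for the input that the exposed edges do not depend on. *)
pose x0 : cube := [ffun=> false].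
pose s0 := ip_order core.
pose nb x y v := [seq u <- s0 | adj (ip_input x y) v u].
pose C := expose (earlier (ip_input x0 x0) s0) s0.
pose SA x := C ++ expose (nb x x0) (ip_order (refuter true)).
pose SB y := expose (nb x0 y) (ip_order (refuter false)).
have nb_size x v : v \in ip_order (refuter true) -> size (nb x x0 v) = 5%N.
  rewrite mem_ip_order => v1; rewrite -(degree_refuter_true x x0 v1).
  rewrite -[RHS](on_card_preimset (f := @enum_val ip_vertex predT)); last first.
    exact/onW_bij/enum_val_bij.
  rewrite [RHS]cardE [X in _ = size X]/enum_mem -enumT.
  rewrite /nb /s0 /ip_order -filter_predI !size_filter; apply: eq_count => u.
  by rewrite !inE /= andbC.
(* Each refuter contributes one [Vertex] token and five [Edge] tokens. *)
exists (size C + 6 * size (ip_order (refuter true)))%N, SA, SB; split.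
  move=> x; rewrite size_cat; congr (_ + _)%N.
  rewrite /expose size_flatten /shape -map_comp.
  rewrite (_ : map _ _ = map (fun=> 6%N) (ip_order (refuter true))).
    by rewrite sumnE big_map big_const_seq count_predT iter_addn_0.
  by apply/eq_in_map => v vA /=; rewrite size_map nb_size.
move=> x y.
have -> : SA x ++ SB y = expose (earlier (ip_input x y) s0) s0 ++
    expose (nb x y) (ip_order (refuter true) ++ ip_order (refuter false)).
  rewrite /SA /SB /expose map_cat flatten_cat -catA.
  congr (_ ++ (_ ++ _)); congr flatten; apply/eq_in_map => v vP;
    rewrite mem_ip_order in vP; congr (_ :: map _ _);
    apply: eq_in_filter => u; rewrite mem_ip_order => uP.
  - by congr (_ && _); apply: adj_core.
  - exact: adj_refuter_true.
  - exact: adj_refuter_false.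
apply: VA_independent_suffix => [|u v].
  apply: uniq_perm => [||u]; rewrite ?enum_uniq //.
    rewrite !cat_uniq !uniq_ip_order /= andbT.
    apply/andP; split; apply/hasPn => u; rewrite ?mem_cat !mem_ip_order.
      by rewrite /core => /orP[] ->; rewrite ?andbF.
    by case: (enum_val u) => [[? [?|[]]] []].
  rewrite !mem_cat !mem_ip_order mem_enum /core.
  by case: (refuter true) (refuter false) => [] [].
rewrite !mem_cat !mem_ip_order /=.
by move=> /orP[] /refuterP[i ->] /orP[] /refuterP[j ->];
   rewrite /corona_adj /= /ip_adj andbF.
Qed.

End InnerProductStream.

Local Open Scope ring_scope.

(** * Lindsey's lemma for the Sylvester-Hadamard matrix *)

Section Lindsey.
Variables (R : realFieldType) (h : nat).
Notation cube := {ffun 'I_h.*2 -> bool}.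

Definition ip_sign (x y : cube) : R := (-1) ^+ inner_product x y.

Lemma ip_signE x y : ip_sign x y = \prod_i (-1) ^+ (x i && y i).
Proof.
rewrite /ip_sign /inner_product.
by rewrite (big_morph (fun b : bool => (-1) ^+ b : R) (@signr_addb R) (erefl : (-1) ^+ false = 1 :> R)).
Qed.

(** The sum factors over coordinates, and one where [x] and [x'] differ gives the factor [1 - 1]. *)
Lemma ip_sign_orthogonal x x' :
  \sum_y ip_sign x y * ip_sign x' y = (2 ^ h.*2)%:R *+ (x == x').
Proof.
under eq_bigr do rewrite !ip_signE -big_split /=.
rewrite -(bigA_distr_bigA (fun i b => (-1) ^+ (x i && b) * (-1) ^+ (x' i && b))).
have [<-|neq_x] := eqVneq x x'.
  under eq_bigr => i _ do rewrite big_bool /= -!expr2 !sqrr_sign.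
  by rewrite prodr_const card_ord mulr1n natrX.
have [i neq_i] : exists i, x i != x' i.
  apply/existsP; apply: contraR neq_x; rewrite negb_exists => /forallP eq_x.
  by apply/eqP/ffunP => i; have := eq_x i; rewrite negbK => /eqP.
rewrite (bigD1 i) //= big_bool !andbF !andbT /=.
by case: (x i) (x' i) neq_i => [] [] // _; rewrite !expr0 !expr1 !mulr1 ?mul1r addNr mul0r.
Qed.

(** Orthogonality bounds the sum of the squared column sums [g y]. AM-GM with weight [c = 2 ^ h]
    replaces Cauchy-Schwarz; this [c] makes both halves of the bound equal to [c ^+ 3]. *)
Lemma lindsey (a b : {set cube}) :
  `|\sum_(x in a) \sum_(y in b) ip_sign x y| <= (2 ^ (3 * h))%:R.
Proof.
pose g y : R := \sum_(x in a) ip_sign x y.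
pose c : R := (2 ^ h)%:R.
have c0 : 0 < c by rewrite ltr0n expn_gt0.
have cardC : #|{: cube}| = (2 ^ h.*2)%N by rewrite card_ffun card_bool card_ord.
have sum_sq : \sum_y g y ^+ 2 <= c ^+ 4.
  have -> : \sum_y g y ^+ 2 = \sum_(x in a) (2 ^ h.*2)%:R.
    under eq_bigr do rewrite expr2 big_distrlr /=.
    rewrite exchange_big; apply: eq_bigr => x ax /=.
    rewrite exchange_big /= (bigD1 x) //= ip_sign_orthogonal eqxx mulr1n.
    rewrite big1 ?addr0 // => x' /andP[_ neq_x].
    by rewrite ip_sign_orthogonal eq_sym (negbTE neq_x).
  rewrite sumr_const -mulrnA -natrX ler_nat -expnM mulnC.
  rewrite (leq_trans (leq_mul (max_card a) (leqnn _))) // cardC -expnD.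
  by rewrite leq_exp2l // -addnn; lia.
rewrite exchange_big (le_trans (ler_norm_sum _ _ _)) //=.
(* AM-GM: [|t| <= (t^2 / c + c) / 2] *)
have amgm t : `|t| <= (t ^+ 2 / c + c) / 2.
  rewrite -(ler_pM2r c0) -(real_normK (num_real t)).
  have -> : (`|t| ^+ 2 / c + c) / 2 * c = (`|t| ^+ 2 + c ^+ 2) / 2.
    by field; rewrite gt_eqF.
  by have := sqr_ge0 (`|t| - c); nra.
apply: le_trans (_ : \sum_(y : cube) (g y ^+ 2 / c + c) / 2 <= _).
  rewrite big_mkcond; apply: ler_sum => y _ /=; case: ifP => _ //.
  by rewrite (le_trans _ (amgm (g y))).
rewrite -mulr_suml big_split /= -mulr_suml sumr_const cardC.
have -> : c *+ 2 ^ h.*2 = c ^+ 3.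
  by rewrite -mulr_natr -muln2 expnM natrX -exprS.
have -> : (2 ^ (3 * h))%:R = (c ^+ 4 / c + c ^+ 3) / 2.
  by rewrite mulnC expnM natrX -/c; field; rewrite gt_eqF.
by rewrite ler_pM2r ?invr_gt0 // lerD2r ler_pM2r ?invr_gt0.
Qed.

End Lindsey.

(** * Discrepancy bounds for multi-pass streaming algorithms *)

Section Discrepancy.
Variables (R : realType) (n s : nat) (A : stream_alg R n s).
Variables (X Y : finType) (SA : X -> seq (token 'I_n)) (SB : Y -> seq (token 'I_n)).
(* The transition functions see the position in the stream, so the second half
   has to start at a position that does not depend on the first one. *)
Variables (t0 : nat) (size_SA : forall x, size (SA x) = t0).
Variables (f : X -> Y -> bool) (D : R).
Hypothesis discrepancy : forall (a : {set X}) (b : {set Y}),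
  `|\sum_(x in a) \sum_(y in b) (-1) ^+ f x y| <= D.

Lemma read_stream_cat (w : seed A) i t m S S' :
  read_stream w i t m (S ++ S') =
  read_stream w i (t + size S) (read_stream w i t m S) S'.
Proof.
by elim: S t m => [|x S IHS] t m /=; rewrite ?addn0 // IHS addSnnS.
Qed.

(** One pass splits the rectangle by the memory [u] at the cut, a function of [x], and the final
    memory [v], a function of [u] and [y]. On each of the [2 ^ (2 * s)] pieces the next pass starts
    from the fixed memory [v]. *)
Lemma rectangle_run (w : seed A) (l : seq nat) m0 (a : {set X}) (b : {set Y}) :
  `|\sum_(x in a) \sum_(y in b) (-1) ^+ f x y *
      (-1) ^+ output w
        (foldl (fun m i => read_stream w i 0 m (SA x ++ SB y)) m0 l)|
  <= (2 ^ (s * (size l).*2))%:R * D.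
Proof.
elim: l m0 a b => [|i l IHl] m0 a b /=.
  under eq_bigr do rewrite -mulr_suml.
  by rewrite -mulr_suml normrM normr_sign mulr1 muln0 mul1r discrepancy.
pose rA x := read_stream w i 0 m0 (SA x).
pose rB u y := read_stream w i t0 u (SB y).
set F := (F in \sum_(x in a) \sum_(y in b) F x y).
pose G v x y := (-1) ^+ f x y * (-1) ^+ output w
  (foldl (fun m i => read_stream w i 0 m (SA x ++ SB y)) v l) : R.
have -> : \sum_(x in a) \sum_(y in b) F x y =
    \sum_u \sum_v \sum_(x in [set x in a | rA x == u])
      \sum_(y in [set y in b | rB u y == v]) G v x y.
  rewrite (partition_big rA xpredT) //=; apply: eq_bigr => u _.
  rewrite [RHS]exchange_big /=.
  apply: eq_big => [x|x /andP[_ /eqP rx]]; first by rewrite inE.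
  rewrite (partition_big (rB u) xpredT) //=; apply: eq_bigr => v _.
  apply: eq_big => [y|y /andP[_ /eqP ry]]; first by rewrite inE.
  by rewrite /F /G read_stream_cat size_SA add0n -/(rA x) rx -/(rB u y) ry.
have cardM : #|{: s.-tuple bool}| = (2 ^ s)%N by rewrite card_tuple card_bool.
apply: le_trans (_ : \sum_(u : s.-tuple bool) \sum_(v : s.-tuple bool)
    (2 ^ (s * (size l).*2))%:R * D <= _).
  rewrite (le_trans (ler_norm_sum _ _ _)) //; apply: ler_sum => u _.
  by rewrite (le_trans (ler_norm_sum _ _ _)) //; apply: ler_sum => v _; apply: IHl.
rewrite !sumr_const cardM -mulrnA -[leLHS]mulr_natl mulrA -natrM.
by rewrite -!expnD doubleS !mulnS addnA.
Qed.

(** Success probability [2 / 3] means correlation at least [1 / 3] with [f] on every input; averaged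
    over seeds, it is limited by the bound for deterministic runs. *)
Lemma discrepancy_bound (p : nat) :
  (forall x y, 2 / 3 <= prob_output A p (SA x ++ SB y) (f x y)) ->
  (#|X| * #|Y|)%:R <= 3 * (2 ^ (s * p.*2))%:R * D.
Proof.
move=> correct.
pose out (w : seed A) x y := output w (run p w (SA x ++ SB y)).
have bias x y : 1 / 3 <= \sum_w weight w * ((-1) ^+ f x y * (-1) ^+ out w x y).
  have -> : \sum_w weight w * ((-1) ^+ f x y * (-1) ^+ out w x y) =
      2 * prob_output A p (SA x ++ SB y) (f x y) - 1.
    rewrite -[X in _ - X](weight_sum1 A) /prob_output [in RHS]big_mkcond mulr_sumr -sumrB.
    apply: eq_bigr => w _; rewrite /out.
    by case: (output _ _) (f x y) => [] [] /=; rewrite ?expr0 ?expr1; ring.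
  by have := correct x y; lra.
have sum_le : \sum_x \sum_y \sum_w weight w * ((-1) ^+ f x y * (-1) ^+ out w x y)
    <= (2 ^ (s * p.*2))%:R * D.
  under eq_bigr do rewrite exchange_big /=.
  rewrite exchange_big -[leRHS]mul1r -[X in _ <= X * _](weight_sum1 A) mulr_suml /=.
  apply: ler_sum => w _; under eq_bigr do rewrite -mulr_sumr.
  rewrite -mulr_sumr ler_wpM2l ?weight_ge0 //.
  have := rectangle_run w (iota 0 p) (init w) setT setT; rewrite size_iota.
  move=> bound; apply: le_trans bound; apply: le_trans (ler_norm _).
  by rewrite le_eqVlt; apply/orP; left; apply/eqP;
     apply: eq_big => [x|x _]; rewrite ?inE //; apply: eq_bigl => y; rewrite inE.
have : \sum_(x : X) \sum_(y : Y) (1 / 3 : R) <= (2 ^ (s * p.*2))%:R * D.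
  apply: le_trans sum_le; apply: ler_sum => x _; apply: ler_sum => y _.
  exact: bias.
rewrite !sumr_const -mulrnA -[leLHS]mulr_natl mulnC -mulrA; lra.
Qed.

End Discrepancy.

(** * The space lower bound *)

Lemma discrepancy_inner_product (R : realType) h
    (a b : {set {ffun 'I_h.*2 -> bool}}) :
  `|\sum_(x in a) \sum_(y in b) (-1) ^+ (~~ inner_product x y)|
    <= (2 ^ (3 * h))%:R :> R.
Proof.
have <- : `|- \sum_(x in a) \sum_(y in b) ip_sign R x y| =
    `|\sum_(x in a) \sum_(y in b) (-1) ^+ (~~ inner_product x y)| :> R.
  rewrite -sumrN; congr `|_|; apply: eq_bigr => x _.
  by rewrite -sumrN; apply: eq_bigr => y _; rewrite signrN.
by rewrite normrN lindsey.
Qed.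

Theorem theorem5p3 :
  exists D : nat, forall (R : realType) (p : nat), (0 < p)%N ->
    stream_hard (fun n G k => cluster_vertex_deletion G k)
                (fun n G => (max_degree G <= D)%N)
                (fun n G S => VA G S)
                (fun n k : nat => n%:R / p%:R : R)
                p.
Proof.
exists 60%N => R p p_gt0 [s [A [small_s solvesA]]].
(* As [n = 40 * h], this constant gives [4 * p * s n k <= h]. *)
have eps_gt0 : 0 < 1 / 160 :> R by lra.
have [n0 le_s] := small_s _ eps_gt0.
(* The summand [n0] makes [n] large enough for [le_s]; the 5 contradicts the bound [h < 4] that the
   final comparison of exponents would give. *)
pose h := (5 + n0)%N; pose m := h.*2; pose k := (7 * m)%N.
pose n := #|{: ip_vertex m}|.
have n_eq : n = (40 * h)%N by rewrite /n card_ip_vertex /m; lia.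
have space : (4 * p * s n k <= h)%N.
  have p0 : 0 < p%:R :> R by rewrite ltr0n.
  have le_n : (n0 <= n)%N by rewrite n_eq /h; lia.
  have := le_s n k le_n; rewrite mulrA ler_pdivlMr // {2}n_eq => le_sp.
  by rewrite -(ler_nat R) !natrM; rewrite natrM in le_sp; lra.
have [t0 [SA [SB [size_SA VA_S]]]] := ip_stream m.
have m_gt1 : (1 < m)%N by rewrite /m; lia.
have correct (x y : {ffun 'I_m -> bool}) :
    2 / 3 <= prob_output (A n k) p (SA x ++ SB y) (~~ inner_product x y).
  rewrite -(cluster_vertex_deletion_ip x y m_gt1).
  rewrite -(cluster_vertex_deletion_relabel _ _ (@enum_val_bij (ip_vertex m))).
  apply: solvesA; last exact: VA_S.
  apply: leq_trans (max_degree_relabel _ _) (max_degree_ip x y).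
  exact: enum_val_inj.
have := discrepancy_bound size_SA (@discrepancy_inner_product R h) correct.
rewrite card_ffun card_bool card_ord -!natrM ler_nat -mulnA -!expnD => le_pow.
(* The factor 3 is raised to [2 ^ 2], leaving only powers of two. *)
have : (2 ^ (m + m) < 2 ^ (2 + (s n k * p.*2 + 3 * h)))%N.
  apply: leq_ltn_trans le_pow _.
  by rewrite [ltnRHS]expnD ltn_mul2r expn_gt0.
by rewrite ltn_exp2l // /m; lia.
Qed.
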